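(* Let $R$ be a non-zero commutative ring and let $S$ be the antipode of the Hopf algebra $\mathtt{NCQSym}$ over $R$. Then the operator $S^{2}-\operatorname{Id}$, when restricted to the homogeneous part of degree $3$ of $\mathtt{NCQSym}$, is nilpotent of degree $2$ (it is non-zero and its square is $0$). In particular, when $\mathbb{Z}$ embeds into $R$, the order of $S^{2}$ on $\mathtt{NCQSym}$ is infinite.
   Context: The Hopf algebra $\mathtt{NCQSym}$ (word quasi-symmetric functions). Put $\mathbb{N}_{n}=\{1,\ldots,n\}$. A set composition $\mathbf{A}=(A_{1},\ldots,A_{\ell})\vDash\mathbb{N}_{n}$ is an ordered collection of non-empty pairwise disjoint sets with union $\mathbb{N}_{n}$. In the ring of power series over $R$ in non-commuting variables $x_{1},x_{2},\ldots$, for $\mathbf{A}\vDash\mathbb{N}_{n}$ of length $\ell$ and $I=\{i_{1}<\cdots<i_{\ell}\}\subseteq\mathbb{N}$, let $x_{I}^{\mathbf{A}}=x_{\eta_{1}}x_{\eta_{2}}\cdots x_{\eta_{n}}$, where $\eta_{k}=i_{j}$ if $k\in A_{j}$, and set $\mathrm{M}_{\mathbf{A}}=\sum_{|I|=\ell}x_{I}^{\mathbf{A}}$ (with $\mathrm{M}_{\emptyset}=1$). $\mathtt{NCQSym}$ is the free $R$-module with basis $\{\mathrm{M}_{\mathbf{A}}\}$, $\mathbf{A}$ running over set compositions of $\mathbb{N}_{n}$ for all $n\geq0$, graded by $n$; it is closed under the product of power series. Its co-multiplication is $\Delta(\mathrm{M}_{\mathbf{A}})=\sum_{k=0}^{\ell}\mathrm{M}_{\operatorname{st}(A_{1},\ldots,A_{k})}\otimes\mathrm{M}_{\operatorname{st}(A_{k+1},\ldots,A_{\ell})}$,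 where $\operatorname{st}$ transports a set composition of a finite $X\subseteq\mathbb{N}$ to one of $\mathbb{N}_{|X|}$ via the order-preserving bijection $X\to\mathbb{N}_{|X|}$; the co-unit is the projection onto degree $0$. This is a connected graded bi-algebra, hence a Hopf algebra, whose antipode is the two-sided convolution inverse of the identity; it preserves the grading. *)

(* Defs.v *)
From HB Require Import structures.
From mathcomp Require Import all_boot all_order all_algebra.
From mathcomp Require Import finmap.
From mathcomp Require Import monalg.

Set Implicit Arguments.
Unset Strict Implicit.
Unset Printing Implicit Defensive.

Import GRing.Theory.

Local Open Scope fset_scope.
Local Open Scope ring_scope.

Definition blocks_ok (A : seq {fset nat}) : bool :=
  (fset0 \notin A) && pairwise (fun B C : {fset nat} => [disjoint B & C]) A.

Definition blocks_cover (A : seq {fset nat}) : {fset nat} :=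
  \bigcup_(B <- A) B.

Definition is_setcomp (X : {fset nat}) (A : seq {fset nat}) : bool :=
  blocks_ok A && (blocks_cover A == X).

Definition Nset (n : nat) : {fset nat} := [fset k in iota 1 n].

(* A set composition of [Nset n], for any n, as the pair of n and its blocks. *)
Definition setcomp : Type :=
  {p : nat * seq {fset nat} | is_setcomp (Nset p.1) p.2}.
HB.instance Definition _ := Choice.on setcomp.

Definition deg (A : setcomp) : nat := (val A).1.
Definition blocks (A : setcomp) : seq {fset nat} := (val A).2.

(* The order-preserving bijection from [X] to {1, ..., #|X|}. *)
Definition rank (X : {fset nat}) (x : nat) : nat := (index x (sort leq X)).+1.

Definition st_blocks (A : seq {fset nat}) : seq {fset nat} :=
  [seq [fset rank (blocks_cover A) x | x in B] | B : {fset nat} <- A].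

Lemma in_cover A x : (x \in blocks_cover A) = has (fun B : {fset nat} => x \in B) A.
Proof.
rewrite /blocks_cover; elim: A => [|B A IH]; first by rewrite big_nil in_fset0.
by rewrite big_cons in_fsetU IH.
Qed.

Lemma rank_inj (X : {fset nat}) : {in X &, injective (rank X)}.
Proof.
move=> x y hx hy [] e; rewrite -[x](@nth_index _ 0%N _ (sort leq X)) ?mem_sort //.
by rewrite e nth_index ?mem_sort.
Qed.

Lemma st_blocksP A : blocks_ok A ->
  is_setcomp (Nset #|` blocks_cover A|) (st_blocks A).
Proof.
move=> /andP[A0 Ad]; set X := blocks_cover A.
have sub B x : B \in A -> x \in B -> x \in X.
  by move=> hB hx; rewrite in_cover; apply/hasP; exists B.
apply/andP; split; first (apply/andP; split).
- apply/negP => /mapP[B hB /esym/eqP]; apply/negP/fset0Pn.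
  have /fset0Pn[x hx] : B != fset0 by apply: contraNneq A0 => <-.
  by exists (rank X x); apply/imfsetP; exists x.
- rewrite /st_blocks -/X pairwise_map.
  have AA : all (mem A) A by apply/allP.
  apply: (sub_in_pairwise _ AA Ad) => B C hB hC /= dBC.
  apply/fdisjointP => _ /imfsetP[x hx ->]; apply/negP => /imfsetP[y hy e].
  have exy : x = y by apply: (@rank_inj X) => //; [apply: sub hx|apply: sub hy].
  by move/fdisjointP: dBC => /(_ x hx); rewrite exy hy.
- have szX : #|` X| = size (sort leq X) by rewrite size_sort.
  apply/eqP/fsetP => r; rewrite in_cover has_map !inE /= mem_iota.
  apply/hasP/idP => [[B hB /imfsetP[x hx ->]]|/andP[r0 rX]].
    rewrite add1n szX /rank /= ltnS index_mem mem_sort.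
    exact: sub hx.
  case: r r0 rX => // r _; rewrite add1n ltnS szX => rX.
  pose x := nth 0%N (sort leq X) r.
  have xX : x \in X by rewrite -(mem_sort leq) mem_nth.
  move: (xX); rewrite in_cover => /hasP[B hB hx].
  exists B => //; apply/imfsetP; exists x => //.
  by rewrite /rank index_uniq // sort_uniq fset_uniq.
Qed.

Definition st (A : seq {fset nat}) (hA : blocks_ok A) : setcomp :=
  exist _ (#|` blocks_cover A|, st_blocks A) (st_blocksP hA).

Lemma blocks_takeP (A : setcomp) k : blocks_ok (take k (blocks A)).
Proof.
have /andP[/andP[A0 Ad] _] : is_setcomp _ (blocks A) := valP A.
apply/andP; split; first by apply: contra A0; apply: mem_take.
exact: subseq_pairwise (take_subseq _ _) Ad.
Qed.

Lemma blocks_dropP (A : setcomp) k : blocks_ok (drop k (blocks A)).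
Proof.
have /andP[/andP[A0 Ad] _] : is_setcomp _ (blocks A) := valP A.
apply/andP; split; first by apply: contra A0; apply: mem_drop.
exact: subseq_pairwise (drop_subseq _ _) Ad.
Qed.

(* The word of x_I^A; blocks and elements of [I] are numbered from 0 here. *)
Definition xword (A : setcomp) (I : {fset nat}) : seq nat :=
  [seq nth 0%N (sort leq I) (find (fun B : {fset nat} => k \in B) (blocks A))
     | k <- iota 1 (deg A)].

Definition letters (w : seq nat) : {fset nat} := [fset i in w].

Section Series.
Variable R : comNzRingType.

(* A power series is its coefficient function on words; the letter i stands for
   the variable x_{i+1}. *)
Definition ncseries := seq nat -> R.

Definition series_one : ncseries := fun w => (w == [::])%:R.

Definition series_mul (f g : ncseries) : ncseries :=
  fun w => \sum_(i < (size w).+1) f (take i w) * g (drop i w).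

(* Blocks are non-empty, so every element of [I] occurs in [xword A I]: only the
   subsets of the letters of [w] can contribute to the coefficient of [w]. *)
Definition Mseries (A : setcomp) : ncseries := fun w =>
  \sum_(I <- fpowerset (letters w) | #|` I| == size (blocks A)) (xword A I == w)%:R.

End Series.

Lemma blocksP (A : setcomp) : is_setcomp (Nset (deg A)) (blocks A).
Proof. exact: valP A. Qed.

Lemma in_Nset n k : (k \in Nset n) = (0 < k <= n)%N.
Proof. by rewrite !inE /= mem_iota add1n ltnS. Qed.

Lemma setcomp_inj (A B : setcomp) : deg A = deg B -> blocks A = blocks B -> A = B.
Proof.
move=> h1 h2; apply: val_inj; move: h1 h2; rewrite /deg /blocks.
by case: (val A) (val B) => ? ? [? ?] /= -> ->.
Qed.

Definition bidx (A : setcomp) (k : nat) : nat :=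
  find (fun B : {fset nat} => k \in B) (blocks A).

Lemma bidx_lt (A : setcomp) k : (bidx A k < size (blocks A))%N = (0 < k <= deg A)%N.
Proof.
have /andP[_ /eqP h] := blocksP A.
by rewrite /bidx -has_find -in_cover h in_Nset.
Qed.

Lemma bidx_eq (A : setcomp) k j : (j < size (blocks A))%N ->
  (k \in nth fset0 (blocks A) j) = (bidx A k == j).
Proof.
move=> hj; apply/idP/eqP => [hk|e]; last first.
  by move: hj; rewrite -e -has_find => /(nth_find fset0).
have /andP[/andP[_ /pairwiseP hd] _] := blocksP A.
have h : has (fun B : {fset nat} => k \in B) (blocks A).
  by apply/hasP; exists (nth fset0 (blocks A) j) => //; apply: mem_nth.
have hb : (bidx A k < size (blocks A))%N by rewrite -has_find.
have hkb := nth_find fset0 h; rewrite -/(bidx A k) in hkb.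
case: (ltngtP (bidx A k) j) => // lt.
- by have /fdisjointP/(_ _ hkb) := hd fset0 _ _ hb hj lt; rewrite hk.
- by have /fdisjointP/(_ _ hk) := hd fset0 _ _ hj hb lt; rewrite hkb.
Qed.

(* The set composition of the positions of [w] whose blocks collect equal
   letters, listed by increasing letter: [Mseries A] is the indicator of the
   words whose [wcomp] is [A]. *)
Definition wblocks (w : seq nat) : seq {fset nat} :=
  [seq [fset k in iota 1 (size w) | nth 0%N w k.-1 == i]
     | i <- sort leq (letters w)].

Lemma mem_letters w i : (i \in letters w) = (i \in w).
Proof. by rewrite !inE. Qed.

Lemma in_wblock w i k :
  (k \in [fset k in iota 1 (size w) | nth 0%N w k.-1 == i])
  = (0 < k <= size w)%N && (nth 0%N w k.-1 == i).
Proof. by rewrite !inE /= mem_iota add1n ltnS. Qed.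

Lemma nth_pred_in w k : (0 < k <= size w)%N -> nth 0%N w k.-1 \in w.
Proof. by case: k => // k /=; apply: mem_nth. Qed.

Lemma wblocksP w : is_setcomp (Nset (size w)) (wblocks w).
Proof.
apply/andP; split; first (apply/andP; split).
- apply/negP => /mapP[i]; rewrite mem_sort mem_letters => iw /fsetP.
  move/(_ (index i w).+1); rewrite in_fset0 in_wblock /= index_mem iw.
  by rewrite nth_index // eqxx.
- rewrite pairwise_map; have := fset_uniq (letters w).
  rewrite -(sort_uniq leq) uniq_pairwise; apply: sub_pairwise => i j /= /eqP ij.
  apply/fdisjointP => k; rewrite in_wblock => /andP[_ /eqP e].
  by rewrite in_wblock negb_and e; apply/orP; right; apply/eqP.
- apply/eqP/fsetP => k; rewrite in_cover in_Nset has_map.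
  apply/hasP/idP => [[i _ /=]|hk]; first by rewrite in_wblock => /andP[].
  exists (nth 0%N w k.-1); first by rewrite mem_sort mem_letters nth_pred_in.
  by rewrite /= in_wblock hk /=.
Qed.

Definition wcomp (w : seq nat) : setcomp := exist _ (size w, wblocks w) (wblocksP w).

Lemma size_sort_fset (I : {fset nat}) : size (sort leq I) = #|` I|.
Proof. by rewrite size_sort. Qed.

Lemma bidx_wcomp w k : (0 < k <= size w)%N ->
  bidx (wcomp w) k = index (nth 0%N w k.-1) (sort leq (letters w)).
Proof.
move=> hk; apply/eqP; have hw : nth 0%N w k.-1 \in sort leq (letters w).
  by rewrite mem_sort mem_letters nth_pred_in.
rewrite -bidx_eq /blocks /=; last by rewrite size_map index_mem.
by rewrite (nth_map 0%N) ?index_mem // in_wblock hk nth_index /=.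
Qed.

Lemma size_xword A I : size (xword A I) = deg A.
Proof. by rewrite size_map size_iota. Qed.

Lemma nth_xword A I k : (0 < k <= deg A)%N ->
  nth 0%N (xword A I) k.-1 = nth 0%N (sort leq I) (bidx A k).
Proof. by case: k => // k /= hk; rewrite (nth_map 0%N) ?size_iota // nth_iota. Qed.

Lemma eq_from_nth1 (v w : seq nat) : size v = size w ->
  (forall k, (0 < k <= size v)%N -> nth 0%N v k.-1 = nth 0%N w k.-1) -> v = w.
Proof. by move=> s h; apply: (eq_from_nth (x0 := 0%N) s) => i hi; apply: (h i.+1). Qed.

Lemma xword_wcomp w : xword (wcomp w) (letters w) = w.
Proof.
apply: eq_from_nth1; rewrite size_xword // => k hk.
rewrite nth_xword // bidx_wcomp // nth_index //.
by rewrite mem_sort mem_letters nth_pred_in.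
Qed.

Lemma size_wcomp w : size (blocks (wcomp w)) = #|` letters w|.
Proof. by rewrite size_map size_sort_fset. Qed.

Lemma letters_xword A (I : {fset nat}) : #|` I| = size (blocks A) ->
  letters (xword A I) = I.
Proof.
move=> hI; apply/fsetP => i; rewrite mem_letters; apply/mapP/idP.
  move=> [k]; rewrite mem_iota add1n ltnS -bidx_lt -hI => hk ->.
  by rewrite -(mem_sort leq) mem_nth // size_sort_fset.
rewrite -(mem_sort leq) => hi; set j := index i (sort leq I).
have hj : (j < size (blocks A))%N by rewrite -hI -size_sort_fset index_mem.
have /andP[/andP[A0 _] _] := blocksP A.
have /fset0Pn[k] : nth fset0 (blocks A) j != fset0.
  by apply: contraNneq A0 => <-; apply: mem_nth.
rewrite bidx_eq // => /eqP e; exists k; last by rewrite -/(bidx A k) e nth_index.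
by rewrite mem_iota add1n ltnS -bidx_lt e.
Qed.

Lemma wcomp_xword A (I : {fset nat}) : #|` I| = size (blocks A) ->
  wcomp (xword A I) = A.
Proof.
move=> hI; apply: setcomp_inj; first exact: size_xword.
have hL := letters_xword hI.
have hs : size (blocks (wcomp (xword A I))) = size (blocks A).
  by rewrite size_wcomp hL.
apply: (eq_from_nth (x0 := fset0) hs) => j; rewrite hs => hj.
apply/fsetP => k; rewrite (bidx_eq (A := A)) // -[blocks (wcomp _)]/(wblocks _) /wblocks hL.
have hj' : (j < size (sort leq I))%N by rewrite size_sort_fset hI.
rewrite (nth_map 0%N) // in_wblock size_xword -bidx_lt.
case: (boolP (bidx A k < _)%N) => hk /=; last first.
  by apply/esym/negbTE; apply: contraNneq hk => ->.
rewrite nth_xword -?bidx_lt // nth_uniq ?sort_uniq ?fset_uniq //.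
by rewrite size_sort_fset hI.
Qed.

Lemma MseriesE (R : comNzRingType) A w : Mseries R A w = (wcomp w == A)%:R.
Proof.
rewrite /Mseries; case: eqP => [<-|nA].
  rewrite big_mkcond (bigD1_seq (letters w)) ?fset_uniq //=; last first.
    by rewrite fpowersetE fsubset_refl.
  rewrite size_wcomp eqxx xword_wcomp eqxx big1 ?addr0 // => I nI.
  case: eqP => // cI; case: eqP => // eI.
  have := letters_xword (A := wcomp w) (I := I); rewrite eI size_wcomp => /(_ cI) e.
  by rewrite e eqxx in nI.
rewrite big1 // => I /eqP cI; case: eqP => // eI.
by case: nA; rewrite -eI wcomp_xword.
Qed.

Lemma wcomp_map (f : nat -> nat) w :
  {in w &, {mono f : x y / (x <= y)%N}} -> wcomp (map f w) = wcomp w.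
Proof.
move=> hf; have finj : {in w &, injective f}.
  by move=> x y hx hy e; apply/eqP; rewrite eqn_leq -(hf x y) // -(hf y x) // e leqnn.
have sw : {subset sort leq (letters w) <= w} by move=> x; rewrite mem_sort mem_letters.
have eL : sort leq (letters (map f w)) = map f (sort leq (letters w)).
  apply: (sorted_eq leq_trans anti_leq); first exact: (sort_sorted leq_total).
    rewrite sorted_map; apply: (@sub_in_sorted _ (mem w) leq).
    - by move=> x y hx hy /=; rewrite hf.
    - by apply/allP => x /sw.
    - exact: (sort_sorted leq_total).
  apply: uniq_perm; first by rewrite sort_uniq fset_uniq.
    rewrite map_inj_in_uniq ?sort_uniq ?fset_uniq //.
    by move=> x y /sw hx /sw hy; apply: finj.
  move=> x; rewrite mem_sort mem_letters; apply/mapP/mapP => -[y hy ->]; exists y => //.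
    by rewrite mem_sort mem_letters.
  exact: sw.
apply: setcomp_inj; first by rewrite /deg /= size_map.
rewrite /blocks /= /wblocks eL -map_comp; apply/eq_in_map => i /sw hi /=.
apply/fsetP => k; rewrite !in_wblock size_map; case: (boolP (_ < k <= _)%N) => //= hk.
rewrite (nth_map 0%N); last by case: k hk.
by rewrite (inj_in_eq finj) // nth_pred_in.
Qed.

Lemma mono_nth_sort (I : {fset nat}) a b :
  (a < #|` I|)%N -> (b < #|` I|)%N ->
  (nth 0%N (sort leq I) a <= nth 0%N (sort leq I) b)%N = (a <= b)%N.
Proof.
rewrite -size_sort_fset => ha hb.
have hs : sorted ltn (sort leq I).
  by rewrite ltn_sorted_uniq_leq sort_uniq fset_uniq (sort_sorted leq_total).
have h := sorted_ltn_nth ltn_trans 0%N hs.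
case: (ltngtP a b) => [ab|ba|->]; last by rewrite leqnn.
  by apply/ltnW/h.
by apply/negbTE; rewrite -ltnNge; apply: h.
Qed.

Lemma wcomp_eqP v w : wcomp v = wcomp w ->
  exists2 f : nat -> nat, w = map f v & {in v &, {mono f : x y / (x <= y)%N}}.
Proof.
move=> e; have sL : #|` letters v| = #|` letters w| by rewrite -!size_wcomp e.
have sz : size v = size w by have := congr1 deg e.
pose f x := nth 0%N (sort leq (letters w)) (index x (sort leq (letters v))).
exists f.
  apply: eq_from_nth1 => [|k hk]; first by rewrite size_map.
  rewrite (nth_map 0%N); last by case: k hk => // k; rewrite sz.
  rewrite /f -bidx_wcomp ?sz // e bidx_wcomp // nth_index //.
  by rewrite mem_sort mem_letters nth_pred_in.
move=> x y hx hy; rewrite /f.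
have hi z : z \in v -> (index z (sort leq (letters v)) < #|` letters v|)%N.
  by move=> hz; rewrite -size_sort_fset index_mem mem_sort mem_letters.
rewrite mono_nth_sort -?sL ?hi // -(mono_nth_sort (hi x hx) (hi y hy)).
by rewrite !nth_index // mem_sort mem_letters.
Qed.

Lemma wcomp_take v w i : wcomp v = wcomp w -> wcomp (take i v) = wcomp (take i w).
Proof.
move=> /wcomp_eqP[f -> hf]; rewrite -map_take wcomp_map //.
by move=> x y hx hy; apply: hf; [apply: mem_take hx|apply: mem_take hy].
Qed.

Lemma wcomp_drop v w i : wcomp v = wcomp w -> wcomp (drop i v) = wcomp (drop i w).
Proof.
move=> /wcomp_eqP[f -> hf]; rewrite -map_drop wcomp_map //.
by move=> x y hx hy; apply: hf; [apply: mem_drop hx|apply: mem_drop hy].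
Qed.

Definition cword (A : setcomp) : seq nat := xword A (letters (iota 0 (size (blocks A)))).

Lemma cwordK : cancel cword wcomp.
Proof.
move=> A; apply: wcomp_xword.
rewrite card_fseq undup_id ?iota_uniq // size_iota //.
Qed.

Lemma size_cword A : size (cword A) = deg A.
Proof. exact: size_xword. Qed.

Definition setcomps (n : nat) : {fset setcomp} :=
  [fset wcomp (map val (val t)) | t in {: n.-tuple 'I_n}].

Lemma in_setcomps n A : (A \in setcomps n) = (deg A == n).
Proof.
apply/imfsetP/eqP => [[t _ ->]|e]; first by rewrite /deg /= size_map size_tuple.
pose w := cword A; pose f x := index x (sort leq (letters w)).
have hL x : x \in w -> x \in sort leq (letters w) by rewrite mem_sort mem_letters.
have hi x : x \in w -> (f x < #|` letters w|)%N.
  by move=> /hL; rewrite -size_sort_fset index_mem.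
have hf : {in w &, {mono f : x y / (x <= y)%N}}.
  by move=> x y hx hy; rewrite -(mono_nth_sort (hi x hx) (hi y hy)) !nth_index ?hL.
have sw : size w = n by rewrite size_cword e.
have hn : all (fun x => x < n)%N (map f w).
  rewrite all_map; apply/allP => x hx /=; apply: leq_trans (hi x hx) _.
  by rewrite card_fseq -sw size_undup.
pose u : seq 'I_n := pmap insub (map f w).
have uE : map val u = map f w.
  rewrite (pmap_filter (insubK _)); apply/all_filterP; apply: sub_all hn => x /=.
  by move=> hx; rewrite insubT.
have su : size u == n by rewrite -(size_map val) uE size_map sw.
by exists (Tuple su) => //=; rewrite uE wcomp_map // cwordK.
Qed.

(* The empty set composition, the only one of degree 0. *)
Definition setcomp0 : setcomp := wcomp [::].

(* The free module on set compositions; [toseries] is its (injective) embedding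
   into power series. *)
Definition NCQSym (R : comNzRingType) : Type := {malg R[setcomp]}.

Section NCQSym.
Variable R : comNzRingType.
Local Notation H := (NCQSym R).
Implicit Types (x y z : H) (w : seq nat) (A B C : setcomp).

HB.instance Definition _ := GRing.Lmodule.on H.

Definition Mbasis A : H := << A >>.

Definition toseries x : ncseries R :=
  fun w => \sum_(A <- msupp x) x@_A * Mseries R A w.

Lemma toseriesE x w : toseries x w = x@_(wcomp w).
Proof.
rewrite /toseries; case: (boolP (wcomp w \in msupp x)) => hw; last first.
  rewrite mcoeff_outdom // big1_seq // => A /andP[_ hA]; rewrite MseriesE.
  by case: eqP => [e|_]; rewrite ?mulr0 //; rewrite e hA in hw.
rewrite (bigD1_seq (wcomp w)) ?fset_uniq //= MseriesE eqxx mulr1 big1 ?addr0 //.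
by move=> A nA; rewrite MseriesE eq_sym (negbTE nA) mulr0.
Qed.

Lemma toseries_Mbasis A : toseries (Mbasis A) =1 Mseries R A.
Proof. by move=> w; rewrite toseriesE mcoeffU MseriesE eq_sym. Qed.

Lemma toseries_inj x y : toseries x =1 toseries y -> x = y.
Proof. by move=> h; apply/malgP => A; rewrite -(cwordK A) -!toseriesE. Qed.

(* The coefficients of a product are read on the words [cword C]; [toseriesM]
   below checks that this is the product of power series. *)
Definition Mmul A B : H :=
  \sum_(C <- setcomps (deg A + deg B))
     series_mul (Mseries R A) (Mseries R B) (cword C) *: Mbasis C.

Definition ncq_mul x y : H :=
  \sum_(A <- msupp x) \sum_(B <- msupp y) (x@_A * y@_B) *: Mmul A B.

Lemma toseries_Mmul A B :
  toseries (Mmul A B) =1 series_mul (Mseries R A) (Mseries R B).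
Proof.
move=> w; rewrite toseriesE /Mmul raddf_sum /=.
under eq_bigr => C _ do rewrite mcoeffZ mcoeffU.
have hw : series_mul (Mseries R A) (Mseries R B) (cword (wcomp w)) =
          series_mul (Mseries R A) (Mseries R B) w.
  rewrite /series_mul size_cword; apply: eq_bigr => i _.
  by rewrite !MseriesE (wcomp_take i (cwordK _)) (wcomp_drop i (cwordK _)).
case: (boolP (wcomp w \in setcomps (deg A + deg B))) => hC.
  rewrite (bigD1_seq (wcomp w)) ?fset_uniq //= eqxx mulr1 big1 ?addr0 //.
  by move=> C /negbTE ->; rewrite mulr0.
rewrite big1_seq => [|C /andP[_ hC']]; last first.
  by case: eqP => [e|_]; rewrite ?mulr0 //; rewrite -e hC' in hC.
apply/esym/big1 => i _; rewrite !MseriesE.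
case: eqP => [eA|]; last by rewrite mul0r.
case: eqP => [eB|]; last by rewrite mulr0.
move: hC; rewrite in_setcomps -eA -eB /deg /= => /eqP[].
by rewrite -size_cat cat_take_drop.
Qed.

Lemma toseriesM x y :
  toseries (ncq_mul x y) =1 series_mul (toseries x) (toseries y).
Proof.
move=> w; rewrite toseriesE /ncq_mul raddf_sum /=.
under eq_bigr => A _.
  rewrite raddf_sum /=.
  under eq_bigr => B _ do rewrite mcoeffZ -toseriesE toseries_Mmul.
  over.
rewrite /series_mul /toseries.
under [RHS]eq_bigr => i _ do rewrite big_distrlr /=.
rewrite [RHS]exchange_big; apply: eq_bigr => A _ /=.
rewrite [RHS]exchange_big; apply: eq_bigr => B _ /=.
rewrite mulr_sumr; apply: eq_bigr => i _.
by rewrite mulrACA.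
Qed.

Lemma mcoeffM_wcomp x y w : (ncq_mul x y)@_(wcomp w) =
  \sum_(i < (size w).+1) x@_(wcomp (take i w)) * y@_(wcomp (drop i w)).
Proof.
by rewrite -toseriesE toseriesM; apply: eq_bigr => i _; rewrite !toseriesE.
Qed.

Lemma ncq_coefP x y : (forall w, x@_(wcomp w) = y@_(wcomp w)) -> x = y.
Proof. by move=> h; apply/malgP => A; rewrite -(cwordK A). Qed.

Lemma wcomp_eq0 w : (wcomp w == setcomp0) = (w == [::]).
Proof.
apply/eqP/eqP => [/(congr1 deg)|->] //.
by rewrite /deg /= => /eqP; rewrite size_eq0 => /eqP.
Qed.

Lemma mcoeff_M A B : (Mbasis A)@_B = (A == B)%:R.
Proof. by rewrite mcoeffU. Qed.

Lemma ncq_mulA : associative ncq_mul.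
Proof.
move=> x y z; apply: ncq_coefP => w; rewrite !mcoeffM_wcomp.
pose F i j := x@_(wcomp (take i w)) * y@_(wcomp (drop i (take j w)))
             * z@_(wcomp (drop j w)).
transitivity (\sum_(i < (size w).+1) \sum_(j < (size w).+1 | (i <= j)%N) F i j).
  apply: eq_bigr => i _; rewrite mcoeffM_wcomp mulr_sumr size_drop.
  rewrite -(big_geq_mkord i (size w).+1 xpredT (F i)).
  have -> : \sum_(i <= j < (size w).+1) F i j =
            \sum_(0 <= j < (size w).+1 - i) F i (j + i)%N.
    by have := big_addn 0 (size w).+1 i xpredT (F i); rewrite add0n.
  rewrite subSn -1?ltnS // big_mkord; apply: eq_bigr => j _.
  by rewrite /F mulrA take_drop drop_drop.
rewrite (exchange_big_dep xpredT) //=; apply: eq_bigr => j _.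
rewrite mcoeffM_wcomp mulr_suml size_takel -1?ltnS //.
rewrite (big_ord_widen_cond _ xpredT (fun i => x@_(wcomp (take i (take j w))) *
  y@_(wcomp (drop i (take j w))) * z@_(wcomp (drop j w))) (ltn_ord j)).
by apply: eq_big => i; rewrite ?ltnS // => ij; rewrite /F take_takel.
Qed.

Lemma ncq_mul1 : left_id (Mbasis setcomp0) ncq_mul.
Proof.
move=> x; apply: ncq_coefP => w; rewrite mcoeffM_wcomp big_ord_recl /=.
rewrite take0 drop0 mcoeff_M eqxx mul1r big1 ?addr0 // => i _.
rewrite mcoeff_M eq_sym wcomp_eq0; case: w i => [[]//|a w i] /=.
by rewrite mul0r.
Qed.

Lemma ncq_mulr1 : right_id (Mbasis setcomp0) ncq_mul.
Proof.
move=> x; apply: ncq_coefP => w; rewrite mcoeffM_wcomp big_ord_recr /=.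
rewrite take_size drop_size mcoeff_M eqxx mulr1 big1 ?add0r // => i _.
rewrite mcoeff_M eq_sym wcomp_eq0 -size_eq0 size_drop /= subn_eq0.
by rewrite leqNgt ltn_ord mulr0.
Qed.

Lemma ncq_mulDl : left_distributive ncq_mul +%R.
Proof.
move=> x y z; apply: ncq_coefP => w; rewrite mcoeffD !mcoeffM_wcomp -big_split.
by apply: eq_bigr => i _; rewrite mcoeffD mulrDl.
Qed.

Lemma ncq_mulDr : right_distributive ncq_mul +%R.
Proof.
move=> x y z; apply: ncq_coefP => w; rewrite mcoeffD !mcoeffM_wcomp -big_split.
by apply: eq_bigr => i _; rewrite mcoeffD mulrDr.
Qed.

Lemma ncq_oner_neq0 : Mbasis setcomp0 != 0.
Proof.
apply/eqP => /(congr1 (mcoeff setcomp0)) /eqP.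
by rewrite mcoeff_M eqxx mcoeff0 oner_eq0.
Qed.

HB.instance Definition _ := GRing.Zmodule_isNzRing.Build H
  ncq_mulA ncq_mul1 ncq_mulr1 ncq_mulDl ncq_mulDr ncq_oner_neq0.

Lemma ncq_scaleAl (a : R) x y : a *: (x * y) = (a *: x) * y.
Proof.
apply: ncq_coefP => w; rewrite mcoeffZ !mcoeffM_wcomp mulr_sumr.
by apply: eq_bigr => i _; rewrite mcoeffZ mulrA.
Qed.

HB.instance Definition _ := GRing.Lmodule_isLalgebra.Build R H ncq_scaleAl.

Lemma ncq_scaleAr (a : R) x y : a *: (x * y) = x * (a *: y).
Proof.
apply: ncq_coefP => w; rewrite mcoeffZ !mcoeffM_wcomp mulr_sumr.
by apply: eq_bigr => i _; rewrite mcoeffZ mulrCA.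
Qed.

HB.instance Definition _ := GRing.Lalgebra_isAlgebra.Build R H ncq_scaleAr.

(* The tensor square is the free module on pairs of set compositions. *)
Definition coprodM A : {malg R[(setcomp * setcomp)%type]} :=
  \sum_(k < (size (blocks A)).+1)
     << (st (blocks_takeP A k), st (blocks_dropP A k)) >>.

Definition coprod x : {malg R[(setcomp * setcomp)%type]} :=
  \sum_(A <- msupp x) x@_A *: coprodM A.

Definition counit x : R := x@_setcomp0.

(* Convolution m o (f (x) g) o Delta; meaningful for linear [f] and [g]. *)
Definition conv (f g : H -> H) x : H :=
  \sum_(p <- msupp (coprod x)) (coprod x)@_p *: (f (Mbasis p.1) * g (Mbasis p.2)).

Definition is_antipode (S : {linear H -> H}) : Prop :=
  (forall x, conv S id x = (counit x)%:A) /\ (forall x, conv id S x = (counit x)%:A).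

Definition homogeneous (n : nat) x : bool := all (fun A => deg A == n) (msupp x).

End NCQSym.

Lemma rank_mono (X : {fset nat}) : {in X &, {mono rank X : x y / (x <= y)%N}}.
Proof.
move=> x y hx hy; rewrite /rank ltnS.
have hi z : z \in X -> (index z (sort leq X) < #|` X|)%N.
  by move=> hz; rewrite -size_sort_fset index_mem mem_sort.
by rewrite -(mono_nth_sort (hi x hx) (hi y hy)) !nth_index ?mem_sort.
Qed.

Lemma sort_imfset (X : {fset nat}) (f : nat -> nat) :
  {in X &, {mono f : x y / (x <= y)%N}} -> sort leq [fset f x | x in X] = map f (sort leq X).
Proof.
move=> hf; have finj : {in X &, injective f}.
  by move=> x y hx hy e; apply/eqP; rewrite eqn_leq -(hf x y) // -(hf y x) // e leqnn.
have sw : {subset sort leq X <= X} by move=> x; rewrite mem_sort.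
apply: (sorted_eq leq_trans anti_leq); first exact: (sort_sorted leq_total).
  rewrite sorted_map; apply: (@sub_in_sorted _ (mem X) leq).
  - by move=> x y hx hy /=; rewrite hf.
  - by apply/allP => x /sw.
  - exact: (sort_sorted leq_total).
apply: uniq_perm; first by rewrite sort_uniq fset_uniq.
  rewrite map_inj_in_uniq ?sort_uniq ?fset_uniq //.
  by move=> x y /sw hx /sw hy; apply: finj.
move=> x; rewrite mem_sort; apply/imfsetP/mapP => -[y hy ->]; exists y => //.
  by rewrite mem_sort.
exact: sw.
Qed.

Lemma rank_imfset (X : {fset nat}) (f : nat -> nat) x :
  {in X &, {mono f : x y / (x <= y)%N}} -> x \in X ->
  rank [fset f y | y in X] (f x) = rank X x.
Proof.
move=> hf hx; have finj : {in X &, injective f}.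
  by move=> y z hy hz e; apply/eqP; rewrite eqn_leq -(hf y z) // -(hf z y) // e leqnn.
rewrite /rank sort_imfset //; congr _.+1.
have hs : {subset sort leq X <= X} by move=> y; rewrite mem_sort.
have : x \in sort leq X by rewrite mem_sort.
elim: (sort leq X) hs => // y s IH hs; rewrite inE /= => hxs.
have hy : y \in X by apply: hs; rewrite inE eqxx.
rewrite (inj_in_eq finj) //; case: (eqVneq y x) hxs => //= nyx.
by move=> hxs; rewrite IH // => z hz; apply: hs; rewrite inE hz orbT.
Qed.

Definition mapb (f : nat -> nat) (A : seq {fset nat}) : seq {fset nat} :=
  [seq [fset f x | x in B] | B : {fset nat} <- A].

Lemma cover_mapb f A : blocks_cover (mapb f A) = [fset f x | x in blocks_cover A].
Proof.
apply/fsetP => y; rewrite in_cover has_map; apply/hasP/imfsetP.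
  move=> [B hB /imfsetP[x hx ->]]; exists x => //=.
  by rewrite in_cover; apply/hasP; exists B.
move=> [x /=]; rewrite in_cover => /hasP[B hB hx] ->.
by exists B => //; apply/imfsetP; exists x.
Qed.

Lemma st_mapb f A : {in blocks_cover A &, {mono f : x y / (x <= y)%N}} ->
  st_blocks (mapb f A) = st_blocks A.
Proof.
move=> hf; rewrite /st_blocks cover_mapb /mapb -map_comp; apply/eq_in_map => B hB /=.
have sB x : x \in B -> x \in blocks_cover A.
  by move=> hx; rewrite in_cover; apply/hasP; exists B.
apply/fsetP => y; apply/imfsetP/imfsetP => -[x /=].
  by move=> /imfsetP[z /= hz ->] ->; exists z; rewrite // rank_imfset // sB.
move=> hx ->; exists (f x); last by rewrite rank_imfset // sB.
by apply/imfsetP; exists x.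
Qed.

Lemma st_eq A B (hA : blocks_ok A) (hB : blocks_ok B) (f : nat -> nat) :
  {in blocks_cover A &, {mono f : x y / (x <= y)%N}} -> B = mapb f A -> st hB = st hA.
Proof.
move=> hf e; apply: setcomp_inj; last by rewrite /blocks /= e st_mapb.
rewrite /deg /= e cover_mapb card_in_imfset //= => x y hx hy exy.
by apply/eqP; rewrite eqn_leq -(hf x y) // -(hf y x) // exy leqnn.
Qed.

Lemma cover_sub A B : {subset A <= B} -> blocks_cover A `<=` blocks_cover B.
Proof.
move=> h; apply/fsubsetP => x; rewrite !in_cover => /hasP[C /h hC hx].
by apply/hasP; exists C.
Qed.

Lemma st_st A B C (hA : blocks_ok A) (hB : blocks_ok B) (hC : blocks_ok C) :
  {subset B <= A} -> C = mapb (rank (blocks_cover A)) B -> st hC = st hB.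
Proof.
move=> sub; apply: st_eq => x y hx hy.
by apply: rank_mono; apply: (fsubsetP (cover_sub sub)).
Qed.

Lemma blocks_st A (hA : blocks_ok A) : blocks (st hA) = mapb (rank (blocks_cover A)) A.
Proof. by []. Qed.

Definition lft k A := st (blocks_takeP A k).
Definition rgt k A := st (blocks_dropP A k).

Lemma st_irr A B (hA : blocks_ok A) (hB : blocks_ok B) : A = B -> st hA = st hB.
Proof. by move=> e; apply: setcomp_inj; rewrite /deg /blocks /= e. Qed.

Lemma lft_lft j k A : (j <= k)%N -> lft j (lft k A) = lft j A.
Proof.
move=> jk; rewrite /lft; apply: (st_st (blocks_takeP A k)).
  by move=> B; rewrite -(take_takel _ jk) => /mem_take.
by rewrite blocks_st /mapb -map_take take_takel.
Qed.

Lemma blocks_mid j k A : blocks_ok (drop j (take k (blocks A))).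
Proof.
have /andP[A0 Ad] := blocks_takeP A k.
apply/andP; split; first by apply: contra A0; apply: mem_drop.
exact: subseq_pairwise (drop_subseq _ _) Ad.
Qed.

Lemma rgt_lft j k A : rgt j (lft k A) = st (blocks_mid j k A).
Proof.
rewrite /lft /rgt; apply: (st_st (blocks_takeP A k)).
  by move=> B /mem_drop.
by rewrite blocks_st /mapb -map_drop.
Qed.

Lemma lft_rgt j k A : lft j (rgt k A) = st (blocks_mid k (j + k) A).
Proof.
rewrite /lft /rgt; apply: (st_st (blocks_dropP A k)).
  by move=> B; rewrite -take_drop => /mem_take.
by rewrite blocks_st /mapb -map_take take_drop.
Qed.

Lemma rgt_rgt j k A : rgt j (rgt k A) = rgt (j + k) A.
Proof.
rewrite /rgt; apply: (st_st (blocks_dropP A k)).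
  by move=> B; rewrite -drop_drop => /mem_drop.
by rewrite blocks_st /mapb -map_drop drop_drop.
Qed.

Lemma nb_lft k A : (k <= size (blocks A))%N -> size (blocks (lft k A)) = k.
Proof. by move=> h; rewrite size_map size_takel. Qed.

Lemma nb_rgt k A : size (blocks (rgt k A)) = (size (blocks A) - k)%N.
Proof. by rewrite size_map size_drop. Qed.

Lemma Nset_card n : #|` Nset n| = n.
Proof. by rewrite card_fseq undup_id ?iota_uniq // size_iota. Qed.

Lemma sort_Nset n : sort leq (Nset n) = iota 1 n.
Proof.
apply: (sorted_eq leq_trans anti_leq); first exact: (sort_sorted leq_total).
  exact: iota_sorted.
apply: uniq_perm; rewrite ?sort_uniq ?fset_uniq ?iota_uniq //.
by move=> x; rewrite mem_sort !inE.
Qed.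

Lemma st_id A (h : blocks_ok (blocks A)) : st h = A.
Proof.
have /andP[_ /eqP hc] := blocksP A.
apply: setcomp_inj; first by rewrite /deg /= hc Nset_card.
rewrite /blocks /= /st_blocks hc -[RHS]map_id; apply/eq_in_map => B hB.
have rk x : x \in B -> rank (Nset (deg A)) x = x.
  move=> hx; have : x \in Nset (deg A).
    by rewrite -hc in_cover; apply/hasP; exists B.
  rewrite in_Nset => /andP[x0 xd]; rewrite /rank sort_Nset.
  case: x x0 xd {hx} => // x _ xd; rewrite -{1}(add1n x) -(nth_iota 0 1 xd).
  by rewrite index_uniq ?iota_uniq ?size_iota.
apply/fsetP => y; apply/imfsetP/idP => [[x /= hx ->]|hy]; first by rewrite rk.
by exists y; rewrite ?rk.
Qed.

Lemma lft_all A : lft (size (blocks A)) A = A.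
Proof.
have h : blocks_ok (blocks A) by have /andP[] := blocksP A.
by rewrite -[RHS](st_id h); apply: st_irr; rewrite take_size.
Qed.

Lemma rgt0 A : rgt 0 A = A.
Proof.
have h : blocks_ok (blocks A) by have /andP[] := blocksP A.
by rewrite -[RHS](st_id h); apply: st_irr; rewrite drop0.
Qed.

Lemma blocks0 A : (blocks A == [::]) = (A == setcomp0).
Proof.
apply/eqP/eqP => [e|->].
  have /andP[_ /eqP hc] := blocksP A.
  have d0 : deg A = 0%N by rewrite -(Nset_card (deg A)) -hc e /blocks_cover big_nil.
  by rewrite -(cwordK A) /cword /xword d0.
by apply/size0nil; rewrite size_wcomp card_fseq.
Qed.

Section AntipodeExists.
Variable R : comNzRingType.
Local Notation H := (NCQSym R).
Local Notation M := (Mbasis R).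

Definition lext (K : choiceType) (h : K -> H) (z : {malg R[K]}) : H :=
  \sum_(p <- msupp z) z@_p *: h p.
Lemma lextEw (K : choiceType) (h : K -> H) (z : {malg R[K]}) (d : {fset K}) :
  msupp z `<=` d -> lext h z = \sum_(p <- d) z@_p *: h p.
Proof.
move=> hs; rewrite /lext (big_fset_incl _ hs) // => p _ hp.
by rewrite mcoeff_outdom // scale0r.
Qed.

Lemma lext_linear (K : choiceType) (h : K -> H) : linear (lext h).
Proof.
move=> a x y; pose d := msupp x `|` msupp y.
have hx : msupp x `<=` d by apply: fsubsetUl.
have hy : msupp y `<=` d by apply: fsubsetUr.
have hxy : msupp (a *: x + y) `<=` d.
  by apply: fsubset_trans (msuppD_le _ _) _; apply: fsetSU; apply: msuppZ_le.
rewrite (lextEw h hx) (lextEw h hy) (lextEw h hxy) scaler_sumr -big_split /=.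
by apply: eq_bigr => p _; rewrite mcoeffD mcoeffZ scalerDl scalerA.
Qed.

HB.instance Definition _ (K : choiceType) (h : K -> H) :=
  GRing.isLinear.Build R {malg R[K]} H _ (lext h) (lext_linear h).
Lemma lextU (K : choiceType) (h : K -> H) k : lext h << k >> = h k.
Proof.
rewrite (lextEw h (d := [fset k])); last exact: msuppU_le.
by rewrite big_seq_fset1 mcoeffUU scale1r.
Qed.

Definition cv (f g : setcomp -> H) A : H :=
  \sum_(k < (size (blocks A)).+1) f (lft k A) * g (rgt k A).
Lemma convE f g x : conv f g x = \sum_(A <- msupp x) x@_A *: cv (f \o M) (g \o M) A.
Proof.
rewrite /conv -/(lext (fun p => f (M p.1) * g (M p.2)) (coprod x)) /coprod linear_sum.
apply: eq_bigr => A _; rewrite linearZ_LR /coprodM linear_sum. congr (_ *: _).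
by apply: eq_bigr => k _; rewrite /= lextU.
Qed.

Definition eps A : H := if A == setcomp0 then 1 else 0.

Lemma cvA f g h A : cv (cv f g) h A = cv f (cv g h) A.
Proof.
set n := size (blocks A).
pose F i j := f (lft i A) * g (st (blocks_mid i j A)) * h (rgt j A).
transitivity (\sum_(j < n.+1) \sum_(i < n.+1 | (i <= j)%N) F i j).
  apply: eq_bigr => j _; rewrite {1}/cv mulr_suml nb_lft -1?ltnS //.
  rewrite (big_ord_widen_cond _ xpredT (fun i => f (lft i (lft j A)) * g (rgt i (lft j A)) * h (rgt j A)) (ltn_ord j)).
  apply: eq_big => [i|i ij]; first by rewrite ltnS.
  rewrite lft_lft; last exact: ij.
  by rewrite rgt_lft.
rewrite (exchange_big_dep xpredT) //=; apply: eq_bigr => i _.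
rewrite /cv nb_rgt mulr_sumr.
rewrite -(big_geq_mkord i n.+1 xpredT (F i)).
have -> : \sum_(i <= j < n.+1) F i j = \sum_(0 <= j < n.+1 - i) F i (j + i)%N.
  by have := big_addn 0 n.+1 i xpredT (F i); rewrite add0n.
rewrite subSn -1?ltnS // big_mkord; apply: eq_bigr => j _.
by rewrite /F lft_rgt rgt_rgt mulrA.
Qed.

Lemma eq_cv f f' g g' : f =1 f' -> g =1 g' -> cv f g =1 cv f' g'.
Proof. by move=> e e' A; apply: eq_bigr => k _; rewrite e e'. Qed.

Lemma lft_eq0 k A : (k <= size (blocks A))%N -> (lft k A == setcomp0) = (k == 0%N).
Proof. by move=> h; rewrite -blocks0 -size_eq0 nb_lft. Qed.

Lemma rgt_eq0 k A : (rgt k A == setcomp0) = (size (blocks A) <= k)%N.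
Proof. by rewrite -blocks0 -size_eq0 nb_rgt subn_eq0. Qed.

Lemma cv1 f : cv f eps =1 f.
Proof.
move=> A; rewrite /cv big_ord_recr /= /eps rgt_eq0 leqnn mulr1 lft_all big1 ?add0r //.
by move=> k _; rewrite rgt_eq0 leqNgt ltn_ord mulr0.
Qed.

Lemma c1v f : cv eps f =1 f.
Proof.
move=> A; rewrite /cv big_ord_recl /= /eps lft_eq0 // mul1r rgt0 big1 ?addr0 //.
by move=> k _; rewrite lft_eq0 //= mul0r.
Qed.

Fixpoint SL n A : H := if A == setcomp0 then 1 else
  if n is n'.+1 then - \sum_(k < size (blocks A)) SL n' (lft k A) * M (rgt k A) else 0.
Fixpoint SR n A : H := if A == setcomp0 then 1 else
  if n is n'.+1 then - \sum_(k < size (blocks A)) M (lft k.+1 A) * SR n' (rgt k.+1 A) else 0.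
Lemma SLE n m A : (size (blocks A) <= n)%N -> (size (blocks A) <= m)%N -> SL n A = SL m A.
Proof.
elim: n m A => [|n IH] m A.
  by rewrite leqn0 size_eq0 blocks0 => /eqP -> _; case: m => [|m] /=; rewrite eqxx.
case: m => [|m] hn hm.
  by move: hm; rewrite leqn0 size_eq0 blocks0 => /eqP -> /=; rewrite eqxx.
rewrite /=; case: ifP => [_|_]; first by [].
congr (- _); apply: eq_bigr => k _; congr (_ * _).
have hk := ltn_ord k.
by apply: IH; rewrite (nb_lft (ltnW hk)) -ltnS; apply: leq_trans hk _.
Qed.

Lemma SRE n m A : (size (blocks A) <= n)%N -> (size (blocks A) <= m)%N -> SR n A = SR m A.
Proof.
elim: n m A => [|n IH] m A.
  by rewrite leqn0 size_eq0 blocks0 => /eqP -> _; case: m => [|m] /=; rewrite eqxx.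
case: m => [|m] hn hm.
  by move: hm; rewrite leqn0 size_eq0 blocks0 => /eqP -> /=; rewrite eqxx.
rewrite /=; case: ifP => [_|_]; first by [].
congr (- _); apply: eq_bigr => k _; congr (_ * _).
by apply: IH; rewrite nb_rgt leq_subLR addSn -addnS;
  [apply: leq_trans hn _|apply: leq_trans hm _]; rewrite leq_addl.
Qed.

Definition sl A := SL (size (blocks A)) A.
Definition sr A := SR (size (blocks A)) A.
Lemma slP : cv sl M =1 eps.
Proof.
move=> A; rewrite /cv big_ord_recr /= lft_all.
have -> : M (rgt (size (blocks A)) A) = 1.
  by have /eqP -> : rgt (size (blocks A)) A == setcomp0 by rewrite rgt_eq0.
rewrite mulr1 /eps; case: eqP => [e|/eqP nA].
  by rewrite /sl e (_ : size (blocks setcomp0) = 0%N) ?big_ord0 ?add0r //=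
     ?eqxx //; apply/eqP; rewrite size_eq0 blocks0.
have -> : sl A = SL (size (blocks A)).+1 A by apply: SLE.
rewrite /= (negbTE nA) addrC; apply/eqP; rewrite addrC subr_eq0; apply/eqP.
apply: eq_bigr => k _; congr (_ * _).
by apply: SLE; rewrite ?nb_lft // ltnW.
Qed.

Lemma srP : cv M sr =1 eps.
Proof.
move=> A; rewrite /cv big_ord_recl /= rgt0.
have -> : M (lft 0 A) = 1.
  by have /eqP -> : lft 0 A == setcomp0 by rewrite lft_eq0.
rewrite mul1r /eps; case: eqP => [e|/eqP nA].
  by rewrite /sr e (_ : size (blocks setcomp0) = 0%N) ?big_ord0 ?addr0 //=
     ?eqxx //; apply/eqP; rewrite size_eq0 blocks0.
have -> : sr A = SR (size (blocks A)).+1 A by apply: SRE.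
rewrite /= (negbTE nA) addrC; apply/eqP; rewrite subr_eq0; apply/eqP.
apply: eq_bigr => k _; congr (_ * _).
by apply: SRE; rewrite ?nb_rgt // leq_subr.
Qed.

Lemma slr : sl =1 sr.
Proof.
move=> A; rewrite -(cv1 sl) -(eq_cv (fun _ => erefl) srP) -cvA.
by rewrite (eq_cv slP (fun _ => erefl)) c1v.
Qed.

Lemma lext_eps (x : H) : \sum_(A <- msupp x) x@_A *: eps A = (counit x)%:A.
Proof.
rewrite /counit; case: (boolP (setcomp0 \in msupp x)) => h; last first.
  rewrite [x@_setcomp0]mcoeff_outdom // scale0r big1_seq // => A /andP[_ hA]; rewrite /eps; case: eqP => [e|_].
    by rewrite -e hA in h.
  by rewrite scaler0.
rewrite (bigD1_seq setcomp0) ?fset_uniq //= /eps eqxx big1 ?addr0 // => A /negbTE ->.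
by rewrite scaler0.
Qed.

Theorem antipode_exists : exists S : {linear H -> H}, is_antipode S.
Proof.
exists (lext sl : {linear H -> H}); split=> x; rewrite convE -lext_eps; apply: eq_bigr => A _; congr (_ *: _).
  by rewrite -slP; apply: eq_cv => B //=; apply: lextU.
by rewrite -srP; apply: eq_cv => B //=; rewrite -slr; apply: lextU.
Qed.
End AntipodeExists.

(* Main.v *)
(* A set composition A is encoded by its packed word [cword A], whose j-th letter is
   the index of the block containing j.  In this encoding M_A M_B collects the words
   whose prefix and suffix standardize to the words of A and B, and the two tensor
   factors of Delta(M_A) come from the letters below and above a threshold.  The
   recursion S(M_A) = - \sum_(k < l) S(M_(A_1..A_k)) M_(A_(k+1)..A_l) then gives the
   integer matrix of S in degree n.  In degree 3 it is 13 x 13, and evaluation shows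
   that N = S^2 - 1 satisfies N^2 = 0 and has an entry equal to 1, hence is non-zero
   over every R.  Finally (1 + N)^k = 1 + k N rules out a finite order of S^2 in
   characteristic 0. *)
Require Import Defs.
From mathcomp Require Import all_boot all_order all_algebra finmap monalg.

Set Implicit Arguments.
Unset Strict Implicit.
Unset Printing Implicit Defensive.

Import GRing.Theory.

Local Open Scope fset_scope.
Local Open Scope ring_scope.

(** * Set compositions as packed words *)

Definition pack (w : seq nat) : seq nat := [seq index x (sort leq (undup w)) | x <- w].
(** On a packed word both operations give packed words again: the letters kept are an initial
    segment, or a final segment moved down to start at 0. *)
Definition word_lft k (w : seq nat) : seq nat := [seq x <- w | (x < k)%N].
Definition word_rgt k (w : seq nat) : seq nat := [seq (x - k)%N | x <- w & (k <= x)%N].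

Lemma sort_letters w : sort leq (letters w) = sort leq (undup w).
Proof.
apply/(perm_sortP leq_total leq_trans anti_leq)/uniq_perm; rewrite ?undup_uniq ?fset_uniq //.
by move=> x; rewrite mem_undup mem_letters.
Qed.

Lemma card_letters w : #|` letters w| = size (undup w).
Proof. by rewrite -size_sort_fset sort_letters size_sort. Qed.

Lemma cwordE A : cword A = [seq bidx A k | k <- iota 1 (deg A)].
Proof.
have e : sort leq (letters (iota 0 (size (blocks A)))) = iota 0 (size (blocks A)).
  by rewrite sort_letters undup_id ?iota_uniq // sorted_sort ?iota_sorted //; apply: leq_trans.
rewrite /cword /xword e; apply/eq_in_map => k; rewrite mem_iota add1n ltnS -bidx_lt => hk.
by rewrite nth_iota.
Qed.

Lemma cword_wcomp w : cword (wcomp w) = pack w.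
Proof.
rewrite cwordE; apply: eq_from_nth1; rewrite !size_map size_iota // => -[//|k] /= hk.
by rewrite (nth_map 0%N) ?size_iota // nth_iota // bidx_wcomp //= sort_letters (nth_map 0%N).
Qed.

Lemma size_blocks A : size (blocks A) = size (undup (cword A)).
Proof. by rewrite -{1}(cwordK A) size_wcomp card_letters. Qed.

Lemma map_rank_sort (X : {fset nat}) : map (rank X) (sort leq X) = iota 1 #|` X|.
Proof.
have hu : uniq (sort leq X) by rewrite sort_uniq fset_uniq.
apply: (eq_from_nth (x0 := 0%N)); rewrite size_map size_sort_fset ?size_iota // => i hi.
by rewrite (nth_map 0%N) ?size_sort_fset // nth_iota // /rank index_uniq ?size_sort_fset.
Qed.

(** Standardizing renames the positions monotonically and leaves the numbering of the blocks alone,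
    so the word is read off along the sorted union. *)
Lemma cword_st A (hA : blocks_ok A) :
  cword (st hA) = [seq find (fun B : {fset nat} => x \in B) A | x <- sort leq (blocks_cover A)].
Proof.
rewrite cwordE /deg /= -map_rank_sort -map_comp; apply/eq_in_map => x /=.
rewrite mem_sort => hx; rewrite /bidx /blocks /= /st_blocks find_map.
apply: eq_in_find => B hB /=; apply/imfsetP/idP => [[y /= hy e]|hx']; last by exists x.
rewrite (rank_inj hx _ e) // in_cover; by apply/hasP; exists B.
Qed.

Lemma cword_lft k A : (k <= size (blocks A))%N -> cword (lft k A) = word_lft k (cword A).
Proof.
move=> hk; rewrite /lft cword_st.
have has_take x : has (fun B : {fset nat} => x \in B) (take k (blocks A)) = (bidx A x < k)%N.
  rewrite /bidx -{2}(cat_take_drop k (blocks A)) find_cat; case: ifP => h.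
    by apply/esym; rewrite -{2}(size_takel hk) -has_find.
  by rewrite size_takel // ltnNge leq_addr.
have -> : sort leq (blocks_cover (take k (blocks A))) = [seq x <- iota 1 (deg A) | (bidx A x < k)%N].
  apply: (sorted_eq leq_trans anti_leq); first exact: (sort_sorted leq_total).
    exact/(sorted_filter leq_trans)/iota_sorted.
  apply: uniq_perm; rewrite ?sort_uniq ?fset_uniq ?filter_uniq ?iota_uniq // => x.
  rewrite mem_sort in_cover has_take mem_filter mem_iota add1n ltnS -bidx_lt.
  by case: ltnP => //= h; rewrite (leq_trans h).
rewrite cwordE /word_lft filter_map; apply/eq_in_map => x; rewrite mem_filter /= -has_take => /andP[h _].
by rewrite /bidx -{2}(cat_take_drop k (blocks A)) find_cat h.
Qed.

Lemma cword_rgt k A : (k <= size (blocks A))%N -> cword (rgt k A) = word_rgt k (cword A).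
Proof.
move=> hk; rewrite /rgt cword_st.
have has_drop x : has (fun B : {fset nat} => x \in B) (drop k (blocks A))
   = (k <= bidx A x < size (blocks A))%N.
  apply/(has_nthP fset0)/andP => [[i hi]|[h1 h2]].
    rewrite size_drop ltn_subRL in hi; rewrite nth_drop bidx_eq // => /eqP ->.
    by rewrite leq_addr.
  exists (bidx A x - k)%N; first by rewrite size_drop ltn_sub2r // (leq_ltn_trans h1).
  by rewrite nth_drop subnKC // bidx_eq.
have -> : sort leq (blocks_cover (drop k (blocks A))) = [seq x <- iota 1 (deg A) | (k <= bidx A x)%N].
  apply: (sorted_eq leq_trans anti_leq); first exact: (sort_sorted leq_total).
    exact/(sorted_filter leq_trans)/iota_sorted.
  apply: uniq_perm; rewrite ?sort_uniq ?fset_uniq ?filter_uniq ?iota_uniq // => x.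
  by rewrite mem_sort in_cover has_drop mem_filter mem_iota add1n ltnS -bidx_lt.
rewrite cwordE /word_rgt filter_map -map_comp; apply/eq_in_map => x.
rewrite mem_filter /= => /andP[h _].
rewrite /bidx -{2}(cat_take_drop k (blocks A)) find_cat size_takel //.
(* If [x] lay in one of the first [k] blocks, then [bidx A x < k], against [h]. *)
case: ifP => [|_]; last by rewrite addKn.
move=> /(has_nthP fset0)[i]; rewrite size_takel // => hi.
rewrite nth_take // bidx_eq ?(leq_trans hi) // => /eqP e.
by rewrite e leqNgt hi in h.
Qed.

(** * The recursion for the antipode on words *)

Lemma size_word_lft_rgt k u : size u = (size (word_lft k u) + size (word_rgt k u))%N.
Proof.
rewrite /word_lft /word_rgt size_map !size_filter -(count_predC (fun x => x < k)%N u).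
by congr addn; apply: eq_count => x /=; rewrite -leqNgt.
Qed.

(* The coefficient of M_(wcomp w) in S(M_(wcomp u)), for [u] packed with at
   most [n] distinct letters. When [w] is shorter than [v], the truncated [i] is 0 and
   the test on [drop i w] fails by size. *)
Fixpoint antipode_coef n (u w : seq nat) : int :=
  if u is [::] then (w == [::])%:R else
  if n is n'.+1 then
    - foldr +%R 0 [seq let v := word_rgt k u in let i := (size w - size v)%N in
        if pack (drop i w) == v then antipode_coef n' (word_lft k u) (take i w) else 0
      | k <- index_iota 0 (size (undup u))]
  else 0.

Lemma size_pack w : size (pack w) = size w.
Proof. by rewrite size_map. Qed.

(** The antipode preserves the grading: a suffix matching the right factor forces the remaining
    lengths to differ as well. *)
Lemma antipode_coef_size n u w : size u != size w -> antipode_coef n u w = 0.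
Proof.
elim: n u w => [|n IH] [|a u] w //=; try by case: w.
move=> hs; rewrite foldrE big_map big_seq_cond big1 ?oppr0 // => k _.
case: eqP => // /(congr1 size); rewrite size_pack size_drop => e.
apply: IH; rewrite size_take_min.
apply: contraNneq hs => {}IH.
(* The left side of [e] is a truncated difference, hence at most [size w]. *)
have hv : (size (word_rgt k (a :: u)) <= size w)%N by rewrite -e leq_subr.
rewrite -[(size u).+1]/(size (a :: u)) (size_word_lft_rgt k) IH.
by rewrite (minn_idPl (leq_subr _ _)) subnK.
Qed.

(** * Enumeration of the packed words of given length *)

Fixpoint words m n : seq (seq nat) :=
  if n is n'.+1 then [seq x :: w | x <- iota 0 m, w <- words m n'] else [:: [::]].

Lemma mem_words m n w : (w \in words m n) = (size w == n) && all (fun x => x < m)%N w.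
Proof.
elim: n w => [|n IH] w; first by case: w.
apply/allpairsP/idP => [[[x v] /= [hx]]|].
  by rewrite IH => /andP[/eqP hv hw] ->; move: hx; rewrite mem_iota /= hv eqxx hw => ->.
case: w => // x w /= /andP[hs /andP[hx hw]]; exists (x, w); split=> //=.
  by rewrite mem_iota.
by rewrite IH -eqSS hs.
Qed.

(** An alphabet of [n] letters suffices, since a word of length [n] has at most [n] distinct
    letters. *)
Definition packed n := undup [seq pack w | w <- words n n].

Lemma perm_packed n : perm_eq [seq cword A | A <- setcomps n] (packed n).
Proof.
apply: uniq_perm; rewrite ?undup_uniq //.
  by rewrite map_inj_uniq ?fset_uniq //; apply: can_inj cwordK.
move=> w; rewrite mem_undup; apply/mapP/mapP => [[A]|[v]].
  rewrite in_setcomps => /eqP hA ->; exists (cword A); last by rewrite -cword_wcomp cwordK.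
  rewrite mem_words size_cword hA eqxx; apply/allP => x; rewrite cwordE => /mapP[k hk ->].
  move: hk; rewrite mem_iota add1n ltnS -bidx_lt => /leq_trans; apply.
  by rewrite size_blocks -hA -size_cword size_undup.
rewrite mem_words => /andP[/eqP hv _] ->; exists (wcomp v); last by rewrite cword_wcomp.
by rewrite in_setcomps /deg /= hv.
Qed.

Lemma uniq_packed n : uniq (packed n).
Proof. exact: undup_uniq. Qed.

Lemma packed_word n u : u \in packed n -> size u = n /\ pack u = u.
Proof.
rewrite mem_undup => /mapP[v]; rewrite mem_words => /andP[/eqP hv _] ->.
by rewrite size_pack -!cword_wcomp cwordK.
Qed.

(** Among all cuts of [w], only the one whose suffix has length [deg B] can contribute. If [w] is
    too short, the truncated cut is at 0 and the test fails by degree. *)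
Lemma mcoeff_mul_Mbasis (R : comNzRingType) (x : NCQSym R) B w :
  (x * Mbasis R B)@_(wcomp w) =
  (if wcomp (drop (size w - deg B) w) == B then x@_(wcomp (take (size w - deg B) w)) else 0).
Proof.
rewrite [LHS]mcoeffM_wcomp.
case: (ltnP (size w) (deg B)) => hB.
  have -> : (size w - deg B = 0)%N by apply/eqP; rewrite subn_eq0 ltnW.
  rewrite drop0 ifN; last by apply: contraTneq hB => <-; rewrite /deg /= ltnn.
  apply: big1 => i _; rewrite mcoeff_M; case: eqP => [e|_]; last by rewrite mulr0.
  by move: hB; rewrite e /deg /= size_drop ltnNge leq_subr.
have hi : (size w - deg B < (size w).+1)%N by rewrite ltnS leq_subr.
rewrite (bigD1 (Ordinal hi)) //= big1 ?addr0.
  by rewrite mcoeff_M eq_sym; case: eqP => _; rewrite ?mulr1 ?mulr0.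
move=> i /negbTE ni; rewrite mcoeff_M; case: eqP => [e|_]; last by rewrite mulr0.
case/eqP: ni; apply: val_inj; rewrite /= e /deg /= size_drop subKn //.
by rewrite -ltnS.
Qed.

(** * Integer matrices of operators in degree [n] *)

Definition coef_mul n (F G : seq nat -> seq nat -> int) u w : int :=
  foldr +%R 0 [seq F u v * G v w | v <- packed n].

(** Row [u] holds the image of the basis element of [u], so composites multiply in the order of
    application. Integer entries let one computation serve every [R]. *)
Definition represents (R : comNzRingType) n (g : NCQSym R -> NCQSym R)
    (F : seq nat -> seq nat -> int) : Prop :=
  {in packed n, forall u, g (Mbasis R (wcomp u)) =
    \sum_(w <- packed n) (F u w)%:~R *: Mbasis R (wcomp w)}.

Section Represents.
Variables (R : comNzRingType) (n : nat).
Local Notation H := (NCQSym R).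
Local Notation M := (Mbasis R).
Implicit Types (F G : seq nat -> seq nat -> int).

Lemma homogeneous_expand (x : H) : (forall B, deg B != n -> x@_B = 0) ->
  x = \sum_(w <- packed n) x@_(wcomp w) *: M (wcomp w).
Proof.
move=> hx; rewrite -(perm_big _ (perm_packed n)) big_map.
under eq_bigr => A _ do rewrite cwordK.
apply/malgP => B; rewrite raddf_sum /=.
under eq_bigr => A _ do rewrite mcoeffZ mcoeff_M.
case: (boolP (B \in setcomps n)) => hB.
  rewrite (bigD1_seq B) ?fset_uniq //= eqxx mulr1 big1 ?addr0 // => A /negbTE ->.
  by rewrite mulr0.
rewrite hx -?in_setcomps // big1_seq // => A /andP[_ hA].
by case: eqP => [e|]; rewrite ?mulr0 //; rewrite -e hA in hB.
Qed.

Lemma homogeneous_coef (x : H) B : homogeneous n x -> deg B != n -> x@_B = 0.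
Proof.
move=> /allP hx hB; apply/mcoeff_outdom/negP => /hx.
by rewrite (negbTE hB).
Qed.

Lemma eq_represents (g : H -> H) F G :
  {in packed n &, F =2 G} -> represents n g F -> represents n g G.
Proof.
move=> e hF u hu; rewrite hF //; apply: eq_big_seq => w hw.
by rewrite e.
Qed.

Lemma represents_comp (g : H -> H) (h : {linear H -> H}) F G :
  represents n g F -> represents n h G -> represents n (h \o g) (coef_mul n F G).
Proof.
move=> hF hG u hu /=; rewrite hF // linear_sum.
under eq_big_seq => v hv do rewrite linearZ_LR hG // scaler_sumr.
rewrite exchange_big; apply: eq_bigr => w _ /=.
rewrite /coef_mul foldrE big_map rmorph_sum scaler_suml /=.
by apply: eq_bigr => v _; rewrite scalerA rmorphM.
Qed.

Lemma represents_id : represents n (id : H -> H) (fun u w => (u == w)%:R).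
Proof.
move=> u hu; rewrite (bigD1_seq u) ?uniq_packed //= eqxx scale1r big1 ?addr0 // => w.
by rewrite eq_sym => /negbTE ->; rewrite scale0r.
Qed.

Lemma represents_sub (g h : H -> H) F G : represents n g F -> represents n h G ->
  represents n (g \- h) (fun u w => F u w - G u w).
Proof.
move=> hF hG u hu /=; rewrite hF // hG // -sumrB.
by apply: eq_bigr => w _; rewrite rmorphB scalerBl.
Qed.

Lemma represents_eq0 (g : {linear H -> H}) F (x : H) :
  represents n g F -> {in packed n &, forall u w, F u w = 0} -> homogeneous n x -> g x = 0.
Proof.
move=> hF F0 /homogeneous_coef hx; rewrite (homogeneous_expand (x := x)); last by move=> B; apply: hx.
rewrite linear_sum big1_seq // => u /andP[_ hu]; rewrite linearZ_LR hF //.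
by rewrite big1_seq ?scaler0 // => w /andP[_ hw]; rewrite F0 // scale0r.
Qed.

Lemma represents_coef (g : H -> H) F u w : represents n g F ->
  u \in packed n -> w \in packed n -> (g (M (wcomp u)))@_(wcomp w) = (F u w)%:~R.
Proof.
move=> hF hu hw; rewrite hF // raddf_sum /=.
under eq_bigr => v _ do rewrite mcoeffZ mcoeff_M.
rewrite (bigD1_seq w) ?uniq_packed //= eqxx mulr1 big1_seq ?addr0 // => v /andP[vw hv].
(* Packing fixes the members of [packed n], so distinct ones have distinct set compositions. *)
rewrite -(inj_eq (can_inj cwordK)) !cword_wcomp.
by rewrite (packed_word hv).2 (packed_word hw).2 (negbTE vw) mulr0.
Qed.

End Represents.

(** * The matrix of an antipode *)

Section Antipode.
Variables (R : comNzRingType) (S : {linear NCQSym R -> NCQSym R}).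
Hypothesis hS : is_antipode S.
Local Notation H := (NCQSym R).
Local Notation M := (Mbasis R).

Lemma antipode_cv : cv (S \o M) M =1 eps R.
Proof.
move=> A; have := hS.1 (M A).
by rewrite convE -lext_eps -!/(lext _ _) !lextU.
Qed.

Lemma antipode1 : S (M setcomp0) = M setcomp0.
Proof.
have := antipode_cv setcomp0; rewrite /eps eqxx /cv.
have -> : size (blocks setcomp0) = 0%N by apply/eqP; rewrite size_eq0 blocks0.
rewrite big_ord1.
have /eqP -> : rgt 0 setcomp0 == setcomp0 by rewrite rgt0.
have /eqP -> : lft 0 setcomp0 == setcomp0 by rewrite lft_eq0.
by move=> /=; rewrite [M setcomp0]/(1 : H) mulr1.
Qed.

(** The term of the convolution that cuts after the last block is [S (M A)] itself; the sum vanishes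
    in positive degree. *)
Lemma antipode_rec A : A != setcomp0 ->
  S (M A) = - \sum_(k < size (blocks A)) S (M (lft k A)) * M (rgt k A).
Proof.
move=> nA; have := antipode_cv A.
rewrite /eps (negbTE nA) /cv big_ord_recr /= lft_all.
have /eqP -> : rgt (size (blocks A)) A == setcomp0 by rewrite rgt_eq0.
by rewrite [M setcomp0]/(1 : H) mulr1 addrC => /eqP; rewrite addr_eq0 => /eqP.
Qed.

(** Induction on the bound for the number of blocks: a proper left part [lft k A] has only [k]
    blocks. *)
Lemma mcoeff_antipode n A w : (size (blocks A) <= n)%N ->
  (S (M A))@_(wcomp w) = (antipode_coef n (cword A) w)%:~R.
Proof.
have base m v : (S (M setcomp0))@_(wcomp v) = (antipode_coef m (cword setcomp0) v)%:~R.
  rewrite antipode1 mcoeff_M eq_sym wcomp_eq0 cword_wcomp.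
  by case: m => [|m] /=; case: eqP.
elim: n A w => [|n IH] A w.
  by rewrite leqn0 size_eq0 blocks0 => /eqP ->.
case: (eqVneq A setcomp0) => [->|nA] hn //.
rewrite antipode_rec // mcoeffN raddf_sum /=.
have : cword A != [::] by rewrite -wcomp_eq0 cwordK.
case E : (cword A) => [//|a u] _; rewrite /antipode_coef -/antipode_coef -E -size_blocks.
rewrite foldrE big_map rmorphN rmorph_sum big_mkord /=; congr (- _).
apply: eq_bigr => k _; have hk := ltn_ord k.
have hr := cword_rgt (ltnW hk).
(* Injectivity of [cword] turns the test on set compositions into the test on packed words. *)
rewrite mcoeff_mul_Mbasis -size_cword hr -(inj_eq (can_inj cwordK)) cword_wcomp hr.
case: eqP => // _; rewrite -cword_lft; last exact: ltnW.
apply: IH.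
by rewrite nb_lft ?(ltnW hk) // -ltnS (leq_trans hk).
Qed.

(** The bound [n] is enough, as [n] positions form at most [n] blocks. *)
Lemma represents_antipode n : represents n S (antipode_coef n).
Proof.
move=> u hu; have [hs hp] := packed_word hu.
have hc w : (S (M (wcomp u)))@_(wcomp w) = (antipode_coef n u w)%:~R.
  by rewrite (mcoeff_antipode (n := n)) ?cword_wcomp ?hp // size_blocks cword_wcomp hp -hs size_undup.
rewrite {1}(homogeneous_expand (n := n) (x := S (M (wcomp u)))).
  by apply: eq_bigr => w _; rewrite hc.
move=> B hB; rewrite -(cwordK B) hc antipode_coef_size //.
by rewrite size_cword hs eq_sym.
Qed.

End Antipode.

(** * Evaluation in degree 3 *)

(* Reading the values of [F] from a table keeps the evaluation in [sqr_sub_id3_sqr0] short. *)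
Definition tabulate (T : eqType) (P : seq T) (F : T -> T -> int) : T -> T -> int :=
  let t := [seq [seq F u w | w <- P] | u <- P] in
  fun u w => nth 0 (nth [::] t (index u P)) (index w P).

Lemma tabulateE (T : eqType) (P : seq T) F : {in P &, tabulate P F =2 F}.
Proof.
move=> u w hu hw; rewrite /tabulate (nth_map u) ?index_mem //.
by rewrite (nth_map u) ?index_mem // !nth_index.
Qed.

Definition sqr_sub_id3 : seq nat -> seq nat -> int :=
  let P := packed 3 in
  let s := tabulate P (antipode_coef 3) in
  tabulate P (fun u w => coef_mul 3 s s u w - (u == w)%:R).

Lemma sqr_sub_id3_sqr0 : {in packed 3 &, forall u w, coef_mul 3 sqr_sub_id3 sqr_sub_id3 u w = 0}.
Proof.
(* The two [let] share the word list and the table, so each is computed once for all entries. *)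
have h : let P := packed 3 in let f := sqr_sub_id3 in
    all (fun u => all (fun w => foldr +%R 0 [seq f u v * f v w | v <- P] == 0) P) P.
  by vm_compute.
by move=> u w hu hw; apply/eqP; move/allP: h => /(_ u hu)/allP/(_ w hw).
Qed.

Lemma sqr_sub_id3_entry1 : exists u w, [/\ u \in packed 3, w \in packed 3 & sqr_sub_id3 u w = 1].
(* The words encode ({1,2},{3}) and ({1},{2,3}). The entry 1 stays non-zero in every non-zero
   ring. *)
Proof. by exists [:: 0; 0; 1]%N, [:: 0; 1; 1]%N; split; vm_compute. Qed.

Lemma represents_sqr_sub_id3 (R : comNzRingType) (S : {linear NCQSym R -> NCQSym R}) :
  is_antipode S -> represents 3 (S \o S \- id) sqr_sub_id3.
Proof.
move=> hS; have hs : represents 3 S (tabulate (packed 3) (antipode_coef 3)).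
  by apply: eq_represents (@represents_antipode R S hS 3) => u w hu hw; rewrite tabulateE.
have := represents_sub (represents_comp hs hs) (@represents_id R 3).
by apply: eq_represents => u w hu hw; rewrite /sqr_sub_id3 tabulateE.
Qed.

(** * Powers of a unipotent operator and the conclusion *)

(** With N = T - 1, the hypothesis says N(N x) = 0, so the binomial expansion of (1 + N)^k x stops
    after the linear term. *)
Lemma iter_unipotent (R : pzRingType) (V : lmodType R) (T : {linear V -> V}) (x : V) k :
  T (T x - x) = T x - x -> iter k T x = x + (T x - x) *+ k.
Proof.
move=> h; elim: k => [|k IH]; first by rewrite addr0.
by rewrite iterS IH linearD linearMn h mulrS addrA subrKC.
Qed.

Theorem corollary5p41 (R : comNzRingType)
    (S : {linear NCQSym R -> NCQSym R}) (hS : is_antipode S) :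
  [/\ exists x : NCQSym R, homogeneous 3 x /\ S (S x) - x <> 0,
      forall x : NCQSym R, homogeneous 3 x ->
        iter 2 (fun y : NCQSym R => S (S y) - y) x = 0
    & injective (fun m : int => m%:~R : R) ->
        forall k : nat, (0 < k)%N ->
          ~ (forall x : NCQSym R, iter k (fun y : NCQSym R => S (S y)) x = x)].
Proof.
pose f : {linear NCQSym R -> NCQSym R} := S \o S \- idfun.
have hf : represents 3 f sqr_sub_id3 by exact: represents_sqr_sub_id3 hS.
have ff0 x : homogeneous 3 x -> f (f x) = 0.
  by move=> hx; apply: (represents_eq0 (g := f \o f) (represents_comp hf hf) sqr_sub_id3_sqr0 hx).
have [u [w [hu hw Nuw]]] := sqr_sub_id3_entry1.
have fuw : (f (Mbasis R (wcomp u)))@_(wcomp w) = 1.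
  by rewrite (represents_coef hf hu hw) Nuw.
have Mu : homogeneous 3 (Mbasis R (wcomp u)).
  apply/allP => A /(fsubsetP msuppU_le); rewrite inE => /eqP ->.
  by rewrite /deg /= (packed_word hu).1.
split.
- exists (Mbasis R (wcomp u)); split=> [//|e].
  by move/eqP: fuw; rewrite [f _]e mcoeff0 eq_sym oner_eq0.
- exact: ff0.
move=> inj k k0 /(_ (Mbasis R (wcomp u))).
rewrite (@iter_unipotent R _ (S \o S)); last first.
  by apply/eqP; rewrite -subr_eq0; apply/eqP; apply: ff0.
(* Order [k] would give k N x = 0; its coefficient at [w] is the image of [k] in [R], so injectivity
   yields k = 0. *)
move=> /(canRL (addKr _)); rewrite addNr => /(congr1 (mcoeff (wcomp w))).
rewrite mcoeffMn [(_ - _)@_ _]fuw mcoeff0 => e.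
by move: k0; rewrite (_ : k = 0%N) //; have [] : k%:Z = 0 by apply: inj.
Qed.
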